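(* Let $G = (V(G), E(G), \mathbf{s}, \mathbf{r})$ be a non-trivial directed graph. Then: (i) the following are equivalent: $\mathrm{diam}(\Gamma(I(G))) = 1$; $I(G)^\times = \mathrm{Min}(I(G)^\times)$; $G$ is a null graph with $|V(G)| \ge 2$; (ii) the following are equivalent: $\mathrm{diam}(\Gamma(I(G))) = 2$; $G$ is not a null graph; there exist distinct elements $pq^{-1}, rs^{-1} \in I(G)^\times$ such that $pq^{-1}$ and $rs^{-1}$ are comparable (with respect to the natural partial order).
   Context: A directed graph $G=(V(G),E(G),\mathbf{s},\mathbf{r})$ has a non-empty vertex set $V(G)$, an edge set $E(G)$ (loops and multiple edges allowed), and source and range maps $\mathbf{s},\mathbf{r}:E(G)\to V(G)$. It is null if it has no edges (only isolated vertices), and trivial if it consists of one isolated vertex; non-trivial otherwise. $\mathrm{Path}(G)$ is the set of all finite directed paths $p=e_1\cdots e_n$ (with $\mathbf{r}(e_i)=\mathbf{s}(e_{i+1})$, $\mathbf{s}(p)=\mathbf{s}(e_1)$, $\mathbf{r}(p)=\mathbf{r}(e_n)$), including each vertex $v$ as an empty path with $\mathbf{s}(v)=\mathbf{r}(v)=v$; $p^{-1}=e_n^{-1}\cdots e_1^{-1}$ and $v^{-1}=v$. The graph inverse semigroup $I(G)$ is the semigroup with zero generated by $V(G)\cup E(G)\cup\{e^{-1}:e\in E(G)\}$ subject to, for $u,v\in V(G)$, $e,f\in E(G)$: $uv=\delta_{u,v}u$; $\mathbf{s}(e)e=e\mathbf{r}(e)=e$; $\mathbf{r}(e)e^{-1}=e^{-1}\mathbf{s}(e)=e^{-1}$;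 $e^{-1}f=\delta_{e,f}\mathbf{r}(e)$. Every non-zero element is uniquely $pq^{-1}$ with $p,q\in\mathrm{Path}(G)$, $\mathbf{r}(p)=\mathbf{r}(q)$; $(pq^{-1})(rs^{-1})$ equals $pts^{-1}$ if $r=qt$, $p(st)^{-1}$ if $q=rt$ (for a possibly empty path $t$), and $0$ otherwise. $I(G)$ is an inverse semigroup with idempotents $pp^{-1}$ ($p\in\mathrm{Path}(G)$) and $0$. $I(G)^\times = I(G)\setminus\{0\}$. For an inverse semigroup $T$ with zero, the natural partial order is $a\le b$ iff $a=eb$ for some idempotent $e$; $\omega(a,b)=\{c\in T:c\le a \text{ and } c\le b\}$. $\mathrm{Min}(T\setminus\{0\})$ is the set of minimal elements of $T\setminus\{0\}$ with respect to $\le$. The zero-divisor graph $\Gamma(T)$ is the simple undirected graph with vertex set $Z(T)^\times=\{a\in T\setminus\{0\}:\exists\,b\in T\setminus\{0\},\ \omega(a,b)=\{0\}\}$, where distinct vertices $a,b$ are adjacent iff $\omega(a,b)=\{0\}$. The distance between two distinct vertices is the length of a shortest path joining them ($\infty$ if there is none), and $\mathrm{diam}$ is the largest distance between pairs of distinct vertices. *)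

(* Defs.v *)
From HB Require Import structures.
From mathcomp Require Import all_boot.
From mathcomp Require Import boolp classical_sets functions cardinality.

Set Implicit Arguments.
Unset Strict Implicit.
Unset Printing Implicit Defensive.

Local Open Scope classical_set_scope.

HB.mixin Record Semigroup_hasZero T of Semigroup T := {
  szero : T;
  szero_mul : left_zero szero (@mul T);
  smul_zero : right_zero szero (@mul T)
}.

#[short(type="semigroup0Type")]
HB.structure Definition Semigroup0 := {T of Semigroup_hasZero T & Semigroup T}.

(* The notions below are meant for inverse semigroups with zero, but only their
   multiplication and zero enter the definitions. *)
Section Semigroup0Defs.
Context {T : semigroup0Type}.
Implicit Types a b c e : T.

Definition nonzero : set T := [set a | a <> szero].

Definition idem e : Prop := (e * e)%g = e.

Definition nle a b : Prop := exists2 e, idem e & a = (e * b)%g.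

Definition ncomparable a b : Prop := nle a b \/ nle b a.

Definition omega a b : set T := [set c | nle c a /\ nle c b].

Definition Min (S : set T) : set T :=
  [set a | S a /\ forall b, S b -> nle b a -> b = a].

Definition zd_vertices : set T :=
  [set a | nonzero a /\ exists2 b, nonzero b & omega a b = [set szero]].

End Semigroup0Defs.

Record sgraph (T : eqType) := SGraph {
  sg_vertices : set T;
  sg_adj : rel T;
  sg_adj_vertices : forall a b, sg_adj a b -> sg_vertices a /\ sg_vertices b;
  sg_adj_sym : symmetric sg_adj;
  sg_adj_irr : irreflexive sg_adj
}.

Section Distance.
Variables (T : eqType) (X : sgraph T).

Definition sg_path (a b : T) (p : seq T) : bool :=
  [&& path (sg_adj X) a p, last a p == b & uniq (a :: p)].

(* Infinite distances and unbounded diameters are those for which no natural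
   number [n] satisfies [has_dist a b n], respectively [has_diam n]. *)
Definition has_dist (a b : T) (n : nat) : Prop :=
  (exists2 p, sg_path a b p & size p = n) /\
  (forall p, sg_path a b p -> n <= size p).

Definition has_diam (n : nat) : Prop :=
  (exists a b, [/\ sg_vertices X a, sg_vertices X b, a <> b & has_dist a b n]) /\
  (forall a b, sg_vertices X a -> sg_vertices X b -> a <> b ->
     exists2 m, has_dist a b m & m <= n).

End Distance.

Section ZeroDivisorGraph.
Variable T : semigroup0Type.

Definition zd_adj : rel T := fun a b =>
  `[< [/\ zd_vertices a, zd_vertices b, a <> b & omega a b = [set szero]] >].

Fact zd_adj_vertices a b : zd_adj a b -> zd_vertices a /\ zd_vertices b.
Proof. by move=> /asboolP[]. Qed.

Fact zd_adj_sym : symmetric zd_adj.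
Proof.
have omegaC (a b : T) : omega a b = omega b a.
  by apply/seteqP; split=> c [].
move=> a b; apply/asboolP/asboolP => -[Za Zb ab ab0]; split=> //;
  by [apply: nesym | rewrite omegaC].
Qed.

Fact zd_adj_irr : irreflexive zd_adj.
Proof. by move=> a; apply/asboolP => -[]. Qed.

Definition zd_graph : sgraph T := SGraph zd_adj_vertices zd_adj_sym zd_adj_irr.

End ZeroDivisorGraph.

Record digraph := Digraph {
  vertex : Type;
  edge : Type;
  src : edge -> vertex;
  rng : edge -> vertex;
  vertex_inhabited : inhabited vertex
}.

Definition null_graph (G : digraph) : Prop := ~ inhabited (edge G).

Definition trivial_graph (G : digraph) : Prop :=
  null_graph G /\ exists v : vertex G, forall u, u = v.

(* [dpath u v]: the paths with source [u] and range [v], empty ones included. *)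
Inductive dpath (G : digraph) : vertex G -> vertex G -> Type :=
| dnil (v : vertex G) : dpath v v
| dcons (e : edge G) (v : vertex G) : dpath (rng e) v -> dpath (src e) v.

(* The graph inverse semigroup is presented as a semigroup with zero: terms over the generators modulo the least congruence [gis_cong] that
   contains the axioms of semigroups with zero and the defining relations. *)

Inductive gis_term (G : digraph) : Type :=
| TZero
| TVertex (v : vertex G)
| TEdge (e : edge G)
| TEdgeInv (e : edge G)
| TMul (x y : gis_term G).
Arguments TZero {G}.
Arguments TVertex {G} v.
Arguments TEdge {G} e.
Arguments TEdgeInv {G} e.

Inductive gis_cong (G : digraph) : gis_term G -> gis_term G -> Prop :=
| cong_refl x : gis_cong x x
| cong_sym x y : gis_cong x y -> gis_cong y x
| cong_trans x y z : gis_cong x y -> gis_cong y z -> gis_cong x z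
| cong_mul x x' y y' :
    gis_cong x x' -> gis_cong y y' -> gis_cong (TMul x y) (TMul x' y')
| cong_assoc x y z : gis_cong (TMul x (TMul y z)) (TMul (TMul x y) z)
| cong_0mul x : gis_cong (TMul TZero x) TZero
| cong_mul0 x : gis_cong (TMul x TZero) TZero
| cong_vv v : gis_cong (TMul (TVertex v) (TVertex v)) (TVertex v)
| cong_uv u v : u <> v -> gis_cong (TMul (TVertex u) (TVertex v)) TZero
| cong_src_edge e : gis_cong (TMul (TVertex (src e)) (TEdge e)) (TEdge e)
| cong_edge_rng e : gis_cong (TMul (TEdge e) (TVertex (rng e))) (TEdge e)
| cong_rng_inv e : gis_cong (TMul (TVertex (rng e)) (TEdgeInv e)) (TEdgeInv e)
| cong_inv_src e : gis_cong (TMul (TEdgeInv e) (TVertex (src e))) (TEdgeInv e)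
| cong_inv_edge e : gis_cong (TMul (TEdgeInv e) (TEdge e)) (TVertex (rng e))
| cong_inv_edge0 e f : e <> f -> gis_cong (TMul (TEdgeInv e) (TEdge f)) TZero.

HB.instance Definition _ (G : digraph) := gen_eqMixin (gis_term G).
HB.instance Definition _ (G : digraph) := gen_choiceMixin (gis_term G).

Section GraphInverseSemigroup.
Variable G : digraph.
Local Open Scope quotient_scope.

Definition gis_equiv : rel (gis_term G) := fun x y => `[< gis_cong x y >].

Fact gis_equiv_refl : reflexive gis_equiv.
Proof. by move=> x; apply/asboolP/cong_refl. Qed.

Fact gis_equiv_sym : symmetric gis_equiv.
Proof. by move=> x y; apply/asboolP/asboolP; apply: cong_sym. Qed.

Fact gis_equiv_trans : transitive gis_equiv.
Proof.
by move=> y x z /asboolP xy /asboolP yz; apply/asboolP/(cong_trans xy yz).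
Qed.

Canonical gis_equiv_rel :=
  EquivRel gis_equiv gis_equiv_refl gis_equiv_sym gis_equiv_trans.

Definition gis := {eq_quot gis_equiv}.

HB.instance Definition _ := Choice.on gis.
HB.instance Definition _ := EqQuotient.on gis.

Fact gis_piP x y : \pi_gis x = \pi_gis y <-> gis_cong x y.
Proof.
split=> [/eqP|xy]; first by rewrite eqmodE => /asboolP.
by apply/eqP; rewrite eqmodE; apply/asboolP.
Qed.

Definition gis_mul (a b : gis) : gis := \pi_gis (TMul (repr a) (repr b)).

Fact gis_reprK x : gis_cong (repr (\pi_gis x)) x.
Proof. by apply/gis_piP/reprK. Qed.

Fact gis_mulE x y : gis_mul (\pi_gis x) (\pi_gis y) = \pi_gis (TMul x y).
Proof. by apply/gis_piP/cong_mul; apply: gis_reprK. Qed.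

Fact gis_mulA : associative gis_mul.
Proof.
move=> a b c; apply/gis_piP.
apply: cong_trans (cong_mul (cong_refl _) (gis_reprK _)) _.
apply: cong_trans (cong_assoc _ _ _) _.
exact: cong_sym (cong_mul (gis_reprK _) (cong_refl _)).
Qed.

HB.instance Definition _ := isSemigroup.Build gis gis_mulA.

Fact gis_0mul : left_zero (\pi_gis TZero) gis_mul.
Proof.
move=> a; apply/gis_piP.
exact: cong_trans (cong_mul (gis_reprK _) (cong_refl _)) (cong_0mul _).
Qed.

Fact gis_mul0 : right_zero (\pi_gis TZero) gis_mul.
Proof.
move=> a; apply/gis_piP.
exact: cong_trans (cong_mul (cong_refl _) (gis_reprK _)) (cong_mul0 _).
Qed.

HB.instance Definition _ := Semigroup_hasZero.Build gis gis_0mul gis_mul0.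

(* A path e_1 ... e_n is sent to e_1 * (... * (e_n * r(e_n))), which is
   e_1 * ... * e_n by the relation e r(e) = e; similarly for its inverse, with
   r(e) e^-1 = e^-1. *)

Fixpoint gis_path u v (p : dpath u v) : gis :=
  match p with
  | dnil v => \pi_gis (TVertex v)
  | dcons e _ p' => (\pi_gis (TEdge e) * gis_path p')%g
  end.

Fixpoint gis_path_inv u v (p : dpath u v) : gis :=
  match p with
  | dnil v => \pi_gis (TVertex v)
  | dcons e _ p' => (gis_path_inv p' * \pi_gis (TEdgeInv e))%g
  end.

Definition gis_elt u v w (p : dpath u w) (q : dpath v w) : gis :=
  (gis_path p * gis_path_inv q)%g.

End GraphInverseSemigroup.

(* Main.v *)
(* Give every generator a degree: 1 for an edge, -1 for an inverse edge, 0 for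
   a vertex.  All defining relations not involving zero are homogeneous, so a
   non-zero element has a well-defined degree, idempotents have degree 0, and
   [c <= a] with [c <> 0] forces [c] and [a] to have the same degree.  Hence
   elements of distinct degrees are adjacent in the zero-divisor graph.  When
   [G] has an edge there are non-zero elements of degrees 0 and 1, so any two
   non-adjacent elements, having equal degree, have a common neighbour, and the
   diameter is 2, attained by [e e^-1 < s(e)].  Without edges, the non-zero
   elements are pairwise orthogonal vertices.

   That the required elements are non-zero and distinct follows from an action
   of [I(G)] by partial bijections: [e] prepends itself to a list of edges and
   [e^-1] removes it. *)

Require Import Defs.
From HB Require Import structures.
From mathcomp Require Import all_boot all_algebra zify.
From mathcomp Require Import boolp classical_sets functions cardinality.

Set Implicit Arguments.
Unset Strict Implicit.
Unset Printing Implicit Defensive.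

Local Open Scope classical_set_scope.
Local Open Scope card_scope.

(** * Distances and diameters in simple graphs *)

Section Diameter.
Variables (T : eqType) (X : sgraph T).

Lemma has_dist_inj (a b : T) m n :
  has_dist X a b m -> has_dist X a b n -> m = n.
Proof.
move=> [[p pab <-] pmin] [[q qab <-] qmin].
by apply/anti_leq; rewrite pmin ?qmin.
Qed.

(** A pair attaining one diameter has its distance bounded by the other. This makes the values 1 and
    2 mutually exclusive. *)
Lemma has_diam_inj m n : has_diam X m -> has_diam X n -> m = n.
Proof.
have le_diam i j : has_diam X i -> has_diam X j -> i <= j.
  move=> [[a [b [Xa Xb ab dab]]] _] [_ /(_ a b Xa Xb ab)[k dk]].
  by rewrite (has_dist_inj dab dk).
by move=> Xm Xn; apply/anti_leq; rewrite !le_diam.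
Qed.

Lemma has_dist1 a b : sg_adj X a b -> has_dist X a b 1.
Proof.
move=> ab; have neq_ab : a != b.
  by apply/eqP => eq_ab; rewrite eq_ab sg_adj_irr in ab.
split=> [|[|//]]; first by exists [:: b]; rewrite // /sg_path /= ab inE neq_ab !eqxx.
by rewrite /sg_path /= (negbTE neq_ab).
Qed.

Lemma has_dist2 a b c :
  a <> b -> ~~ sg_adj X a b -> sg_adj X a c -> sg_adj X c b -> has_dist X a b 2.
Proof.
move=> /eqP neq_ab nab ac cb; split.
  exists [:: c; b] => //; rewrite /sg_path /= ac cb eqxx !inE.
  rewrite !negb_or neq_ab /= !andbT.
  by apply/andP; split; apply/eqP => E; move: ac cb; rewrite E sg_adj_irr.
case=> [|d [|//]]; rewrite /sg_path /=; first by rewrite (negbTE neq_ab).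
by case/and3P=> /andP[ad _] /eqP eq_db; rewrite -eq_db ad in nab.
Qed.

End Diameter.

(** * The natural order and orthogonality *)

Section NaturalOrder.
Variable T : semigroup0Type.
Implicit Types a b c : T.

Lemma nle0 a : nle szero a.
Proof. by exists szero; rewrite /idem szero_mul. Qed.

Lemma omega_eq0 a b :
  omega a b = [set szero] <-> forall c, nle c a -> nle c b -> c = szero.
Proof.
split=> [ab0 c ca cb|ab0]; first by have : omega a b c by []; rewrite ab0.
by apply/seteqP; split=> [c []|c ->]; [apply: ab0 | split; apply: nle0].
Qed.

Lemma omega0_zd_adj a b : nonzero a -> nonzero b -> a <> b ->
  omega a b = [set szero] -> zd_adj a b.
Proof.
move=> a0 b0 ab ab0; apply/asboolP; split=> //; split=> //.
  by exists b.
exists a => //; apply/omega_eq0 => c cb ca.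
by move/omega_eq0: ab0; apply.
Qed.

End NaturalOrder.

Section GraphInverseSemigroup.
Variable G : digraph.
Local Open Scope quotient_scope.
Local Notation cls := (\pi_(gis G)).
Implicit Types (x y : gis_term G) (a b c : gis G).

Lemma cls_mul x y : cls (TMul x y) = (cls x * cls y)%g.
Proof. exact: esym (gis_mulE x y). Qed.

Lemma gis_mul_0 a : (a * szero)%g = szero. Proof. exact: smul_zero. Qed.
Lemma gis_0_mul a : (szero * a)%g = szero. Proof. exact: szero_mul. Qed.

(** * Degrees of non-zero elements *)

Fixpoint term_deg x : int :=
  match x with
  | TZero | TVertex _ => 0
  | TEdge _ => 1
  | TEdgeInv _ => -1
  | TMul y z => term_deg y + term_deg z
  end%R.

(** The first alternative absorbs the relations with right-hand side zero, which are not
    homogeneous; it passes along congruences and products. *)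
Lemma gis_cong_deg x y :
  gis_cong x y -> cls x = szero \/ term_deg x = term_deg y.
Proof.
elim=> {x y} /=; try by [right; lia | left; rewrite !cls_mul ?gis_mul_0 ?gis_0_mul].
- by move=> x y /gis_piP xy [x0|->]; [left; rewrite -xy | right].
- move=> x y z /gis_piP xy [x0|->]; first by left.
  by move=> _ [y0|->]; [left; rewrite xy | right].
- move=> x x' y y' _ [x0|->] _ [y0|->]; rewrite ?cls_mul ?x0 ?y0.
  + by left; rewrite gis_mul_0.
  + by left; rewrite gis_0_mul.
  + by left; rewrite gis_mul_0.
  + by right.
Qed.

(** Read off a chosen representative, hence meaningful only for non-zero [a]. *)
Definition deg a : int := term_deg (repr a).

Lemma deg_cls x : nonzero (cls x) -> deg (cls x) = term_deg x.
Proof. by move=> x0; case: (gis_cong_deg (gis_reprK x)); rewrite ?reprK. Qed.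

Lemma deg_mul a b : nonzero (a * b)%g -> deg (a * b)%g = (deg a + deg b)%R.
Proof.
move=> ab0; have E : (a * b)%g = cls (TMul (repr a) (repr b)) by [].
by rewrite E deg_cls // -E.
Qed.

(** If [c = e a] is non-zero, so is [e], and [e e = e] gives [2 deg e = deg e], so [deg e = 0]. *)
Lemma deg_nle c a : nonzero c -> nle c a -> deg c = deg a.
Proof.
move=> c0 [e ee c_ea]; move: c0; rewrite c_ea => ea0.
have e0 : nonzero (e * e)%g.
  by rewrite ee => e0; apply: ea0; rewrite e0 gis_0_mul.
by rewrite (deg_mul ea0); have := deg_mul e0; rewrite ee; lia.
Qed.

Lemma omega_deg a b : deg a <> deg b -> omega a b = [set szero].
Proof.
move=> dab; apply/omega_eq0 => c ca cb.
by apply: contrapT => c0; apply: dab; rewrite -(deg_nle c0 ca) (deg_nle c0 cb).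
Qed.

(** * The action by partial bijections *)

(* The points of the action are pairs of a list of edges, not required to be
   composable, and a vertex standing for the range of the empty list. *)
Definition point : Type := seq (edge G) * vertex G.

Definition point_src (s : point) : vertex G :=
  if s.1 is e :: _ then src e else s.2.

Definition prepend (e : edge G) (s : point) : point := (e :: s.1, s.2).

(** The graph of a partial map sending [t] to [s]: the output comes first, so that a product acts by
    its right factor and then by its left one. *)
Fixpoint act x (s t : point) : Prop :=
  match x with
  | TZero => False
  | TVertex v => s = t /\ point_src s = v
  | TEdge e => s = prepend e t /\ point_src t = rng e
  | TEdgeInv e => t = prepend e s /\ point_src s = rng e
  | TMul y z => exists2 r, act y s r & act z r t
  end.

Lemma prepend_inj e f s t : prepend e s = prepend f t -> e = f /\ s = t.
Proof. by case: s t => [l u] [m v] [-> -> ->]. Qed.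

(** Each defining relation holds for the partial maps; for [e^-1 f] with [e <> f], lists starting
    with [f] lie outside the domain of [e^-1]. *)
Lemma act_cong x y : gis_cong x y -> forall s t, act x s t <-> act y s t.
Proof.
elim=> {x y} /=.
- by [].
- by move=> x y _ xy s t; rewrite xy.
- by move=> x y z _ xy _ yz s t; rewrite xy yz.
- move=> x x' y y' _ xx _ yy s t.
  by split=> -[r sr rt]; exists r; by [apply/xx | apply/yy].
- move=> x y z s t; split=> [[r sr [q rq qt]]|[q [r sr rq] qt]].
    by exists q => //; exists r.
  by exists r => //; exists q.
- by move=> x s t; split=> // -[].
- by move=> x s t; split=> // -[].
- by move=> v s t; split=> [[r [-> _]]|[-> sv]] //; exists t.
- by move=> u v uv s t; split=> // -[r [-> ru] [_ rv]]; apply: uv; rewrite -ru.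
- by move=> e s t; split=> [[r [-> _]]|[-> te]] //; exists (prepend e t).
- by move=> e s t; split=> [[r [-> re] [<-]]|[-> te]] //; exists t.
- by move=> e s t; split=> [[r [-> _]]|[-> se]] //; exists s.
- by move=> e s t; split=> [[r [-> re] [<-]]|[-> se]] //; exists (prepend e s).
- move=> e s t; split=> [[r [-> se] [/prepend_inj[_ ->]]]|[-> te]] //.
  by exists (prepend e t).
- move=> e f ef s t; split=> // -[r [-> _] [/prepend_inj[]]].
  by move=> /ef.
Qed.

(** Zero acts as the empty map, so one related pair of points suffices. *)
Lemma act_nonzero x s t : act x s t -> nonzero (cls x).
Proof. by move=> xst /gis_piP/act_cong/(_ s t)[/(_ xst)]. Qed.

Lemma vertex_nonzero v : nonzero (cls (TVertex v)).
Proof. exact: (@act_nonzero _ ([::], v) ([::], v)). Qed.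

Lemma vertex_inj u v : cls (TVertex u) = cls (TVertex v) -> u = v.
Proof.
move=> /gis_piP/act_cong/(_ ([::], u) ([::], u)) /= [uv _].
by case: uv.
Qed.

Lemma edge_nonzero e : nonzero (cls (TEdge e)).
Proof. exact: (@act_nonzero _ ([:: e], rng e) ([::], rng e)). Qed.

Lemma edge_idem_nonzero e : nonzero (cls (TMul (TEdge e) (TEdgeInv e))).
Proof.
apply: (@act_nonzero _ ([:: e], rng e) ([:: e], rng e)).
by exists ([::], rng e).
Qed.

Lemma edge_idem_neq_src e :
  cls (TMul (TEdge e) (TEdgeInv e)) <> cls (TVertex (src e)).
Proof.
(* The empty list at [src e] is fixed by the vertex but is not in the image of [e]. *)
move=> /gis_piP/act_cong/(_ ([::], src e) ([::], src e)) /= [_ /(_ (conj erefl erefl))].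
by case=> r [].
Qed.

Lemma edge_idem_idem e : idem (cls (TMul (TEdge e) (TEdgeInv e))).
Proof.
have invE : (cls (TEdgeInv e) * cls (TEdge e))%g = cls (TVertex (rng e)).
  by rewrite -cls_mul; apply/gis_piP/cong_inv_edge.
have edgeK : (cls (TEdge e) * cls (TVertex (rng e)))%g = cls (TEdge e).
  by rewrite -cls_mul; apply/gis_piP/cong_edge_rng.
by rewrite /idem !cls_mul mulgA -[X in (X * _)%g]mulgA invE edgeK.
Qed.

Lemma edge_idem_nle_src e :
  nle (cls (TMul (TEdge e) (TEdgeInv e))) (cls (TVertex (src e))).
Proof.
have invK : (cls (TEdgeInv e) * cls (TVertex (src e)))%g = cls (TEdgeInv e).
  by rewrite -cls_mul; apply/gis_piP/cong_inv_src.
exists (cls (TMul (TEdge e) (TEdgeInv e))); first exact: edge_idem_idem.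
by rewrite !cls_mul -mulgA invK.
Qed.

(** Together with the next lemma, this puts the comparable pair [e e^-1], [s(e)] in the form
    [p q^-1]. *)
Lemma gis_elt_nil v : gis_elt (dnil v) (dnil v) = cls (TVertex v).
Proof. by rewrite /gis_elt /= -cls_mul; apply/gis_piP/cong_vv. Qed.

Lemma gis_elt_edge e :
  gis_elt (dcons (dnil (rng e))) (dcons (dnil (rng e))) =
  cls (TMul (TEdge e) (TEdgeInv e)).
Proof.
rewrite /gis_elt /= -!cls_mul; apply/gis_piP.
exact: cong_mul (cong_edge_rng e) (cong_rng_inv e).
Qed.

(** * Diameter 2 in the presence of an edge *)

Lemma exists_other_deg (k : int) :
  inhabited (edge G) -> exists2 b, nonzero b & k <> deg b.
Proof.
case=> e; have [->|k0] := eqVneq k 0%R.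
  by exists (cls (TEdge e)); rewrite ?deg_cls //; apply: edge_nonzero.
exists (cls (TVertex (src e))); first exact: vertex_nonzero.
by rewrite deg_cls; [apply/eqP | apply: vertex_nonzero].
Qed.

Lemma zd_adj_deg a b : nonzero a -> nonzero b -> deg a <> deg b -> zd_adj a b.
Proof.
move=> a0 b0 dab; apply: omega0_zd_adj => //; last exact: omega_deg.
by move=> ab; apply: dab; rewrite ab.
Qed.

Lemma has_dist_edge a b :
  inhabited (edge G) -> nonzero a -> nonzero b -> a <> b ->
  has_dist (zd_graph (gis G)) a b (if zd_adj a b then 1 else 2).
Proof.
move=> hE a0 b0 ab; case: ifPn => [|nab]; first exact: (@has_dist1 _ (zd_graph _)).
have dab : deg a = deg b.
  by apply: contrapT => dab; case/negP: nab; apply: zd_adj_deg.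
(* As [a] and [b] have equal degree, [c] differs in degree from both and is a common neighbour. *)
have [c c0 dac] := exists_other_deg (deg a) hE.
apply: (has_dist2 (X := zd_graph _) (c := c)) => //; apply: zd_adj_deg => //.
by rewrite -dab; apply: nesym.
Qed.

Lemma has_diam_edge : inhabited (edge G) -> has_diam (zd_graph (gis G)) 2.
Proof.
move=> hE.
have Zn a : nonzero a -> zd_vertices a.
  move=> a0; split=> //; have [b b0 dab] := exists_other_deg (deg a) hE.
  by exists b; last exact: omega_deg.
split=> [|a b [a0 _] [b0 _] ab].
  case: (hE) => e.
  pose a := cls (TMul (TEdge e) (TEdgeInv e)); pose b := cls (TVertex (src e)).
  have a0 : nonzero a := @edge_idem_nonzero e.
  have b0 : nonzero b := @vertex_nonzero (src e).
  have ab : a <> b := @edge_idem_neq_src e.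
  exists a, b; split=> //; [exact: Zn | exact: Zn |].
  have := has_dist_edge hE a0 b0 ab; case: ifP => // /asboolP[_ _ _].
  (* Adjacency fails because [a] is itself a non-zero common lower bound of [a] and [b]. *)
  move=> /omega_eq0/(_ a) E; case: a0; apply: E; last exact: edge_idem_nle_src.
  by exists a; [|apply: esym]; apply: edge_idem_idem.
exists (if zd_adj a b then 1 else 2); [exact: has_dist_edge | by case: ifP].
Qed.

(** * Null graphs *)

Lemma null_gis a : null_graph G -> nonzero a -> exists v, a = cls (TVertex v).
Proof.
move=> nullG; rewrite -[a]reprK; elim: (repr a) => [|v|e|e|x IHx y IHy].
- by [].
- by exists v.
- by case: nullG.
- by case: nullG.
rewrite cls_mul => xy0.
have [|u xu] := IHx; first by move=> x0; apply: xy0; rewrite x0 gis_0_mul.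
have [|v yv] := IHy; first by move=> y0; apply: xy0; rewrite y0 gis_mul_0.
rewrite {}xu {}yv -cls_mul in xy0 *.
have [uv|uv] := pselect (u = v).
  by exists v; rewrite uv; apply/gis_piP/cong_vv.
by case: xy0; apply/gis_piP/cong_uv.
Qed.

(** Both factors of [a = e b] are vertices, and a non-zero product of two vertices forces them to be
    equal. *)
Lemma null_nle a b : null_graph G -> nonzero a -> nle a b -> a = b.
Proof.
move=> nullG a0 [e _ a_eb]; move: a0; rewrite {}a_eb => eb0.
have [|u eu] := null_gis (a := e) nullG.
  by move=> e0; apply: eb0; rewrite e0 gis_0_mul.
have [|v bv] := null_gis (a := b) nullG.
  by move=> b0; apply: eb0; rewrite b0 gis_mul_0.
rewrite {}eu {}bv -cls_mul in eb0 *.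
have [uv|uv] := pselect (u = v); first by rewrite uv; apply/gis_piP/cong_vv.
by case: eb0; apply/gis_piP/cong_uv.
Qed.

Lemma null_zd_adj a b :
  null_graph G -> nonzero a -> nonzero b -> a <> b -> zd_adj a b.
Proof.
move=> nullG a0 b0 ab; apply: omega0_zd_adj => //; apply/omega_eq0 => c ca cb.
(* A non-zero common lower bound would equal both [a] and [b]. *)
apply: contrapT => c0; apply: ab.
by rewrite -(null_nle nullG c0 ca) (null_nle nullG c0 cb).
Qed.

Lemma has_diam_null (u v : vertex G) :
  null_graph G -> u <> v -> has_diam (zd_graph (gis G)) 1.
Proof.
move=> nullG uv; have Euv : cls (TVertex u) <> cls (TVertex v).
  by move/vertex_inj.
have adj := null_zd_adj nullG (@vertex_nonzero u) (@vertex_nonzero v) Euv.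
split=> [|a b [a0 _] [b0 _] ab].
  have [Zu Zv] := zd_adj_vertices adj.
  by exists (cls (TVertex u)), (cls (TVertex v)); split=> //; apply: (has_dist1 (X := zd_graph _)).
exists 1 => //; apply: (has_dist1 (X := zd_graph _)).
exact: null_zd_adj.
Qed.

End GraphInverseSemigroup.

(** * Counting vertices, and the two equivalences *)

Lemma two_card_le (T : Type) :
  [set: 'I_2] #<= [set: T] <-> exists u v : T, u <> v.
Proof.
split=> [/card_leP[f]|[u [v uv]]].
  pose g (i : 'I_2) : T := val (f (SigSub (mem_set (I : [set: 'I_2] i)))).
  exists (g ord0), (g ord_max) => /val_inj fE.
  by have /(congr1 val) := inj (mem_set I) (mem_set I) fE.
have [|f] := (@injfunPex _ _ [set: 'I_2] [set: T]).2; last exact: inj_card_le f.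
exists (fun i => if i == ord0 then u else v) => // i j _ _.
have ord2 (k : 'I_2) : k = ord0 \/ k = ord_max.
  by case: k => [[|[|//]] k2]; [left | right]; apply: val_inj.
by case: (ord2 i) => ->; case: (ord2 j) => -> //= E; case: uv.
Qed.

Lemma null_nontrivial (G : digraph) :
  ~ trivial_graph G -> null_graph G -> exists u v : vertex G, u <> v.
Proof.
move=> ntG nullG; have [v] := vertex_inhabited G.
apply: contrapT => nuv; apply: ntG; split=> //; exists v => u.
by apply: contrapT => uv; apply: nuv; exists u, v.
Qed.

Theorem theorem5p8 (G : digraph) (hG : ~ trivial_graph G) :
  [<-> has_diam (zd_graph (gis G)) 1;
       @nonzero (gis G) = Min (@nonzero (gis G));
       null_graph G /\ [set: 'I_2] #<= [set: vertex G]] /\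
  [<-> has_diam (zd_graph (gis G)) 2;
       ~ null_graph G;
       exists (u v w u' v' w' : vertex G)
              (p : dpath u w) (q : dpath v w) (r : dpath u' w') (s : dpath v' w'),
         [/\ nonzero (gis_elt p q), nonzero (gis_elt r s),
             gis_elt p q <> gis_elt r s &
             ncomparable (gis_elt p q) (gis_elt r s)]].
Proof.
split; tfae.
- move=> diam1; have nullG : null_graph G.
    (* An edge would also give diameter 2. *)
    by move=> /has_diam_edge/(has_diam_inj diam1).
  apply/seteqP; split=> [a a0|a []//]; split=> // b b0.
  exact: null_nle.
- move=> minE; have nullG : null_graph G.
    (* For an edge [e], the vertex [s(e)] is not minimal, since [e e^-1] lies strictly below it. *)
    case=> e; apply: (@edge_idem_neq_src _ e).
    have := @vertex_nonzero G (src e); rewrite minE => -[_]; apply.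
      exact: edge_idem_nonzero.
    exact: edge_idem_nle_src.
  by split=> //; apply/two_card_le/null_nontrivial.
- by case=> nullG /two_card_le[u [v uv]]; apply: has_diam_null uv.
- move=> diam2 nullG; have [u [v uv]] := null_nontrivial hG nullG.
  by have := has_diam_inj diam2 (has_diam_null nullG uv).
- move=> /contrapT[e].
  (* Take [p = q = e] and [r = s] the empty path at [src e]. *)
  exists (src e), (src e), (rng e), (src e), (src e), (src e).
  exists (dcons (dnil _)), (dcons (dnil _)), (dnil _), (dnil _).
  rewrite gis_elt_edge gis_elt_nil; split.
  + exact: edge_idem_nonzero.
  + exact: vertex_nonzero.
  + exact: edge_idem_neq_src.
  + by left; apply: edge_idem_nle_src.
- case=> [u [v [w [u' [v' [w' [p [q [r [s [pq0 rs0 ne cmp]]]]]]]]]]].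
  (* In a null graph comparable non-zero elements coincide. *)
  apply: has_diam_edge; apply: contrapT => nullG; apply: ne.
  by case: cmp => /null_nle; [apply | move=> E; symmetry; apply: E].
Qed.
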